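(* Let $a,b,c,d,e\in\mathbb{R}$ with $b\neq 0$ and let $\mu\geq -1/2$. For every $f\in L^1_\mu(\mathbb{R})$, the quadratic-phase Dunkl transform $\mathcal{D}^{a,b,c}_{d,e,\mu}[f]$ belongs to $\mathcal{C}_0(\mathbb{R})$ and satisfies $$\left\|\mathcal{D}^{a,b,c}_{d,e,\mu}[f]\right\|_{\infty}\leq \frac{c_\mu}{|b|^{\mu+1}}\,\|f\|_{\mu,1}.$$
   Context: For $\mu\ge -1/2$, $L^1_\mu(\mathbb{R})$ is the space of measurable $f:\mathbb{R}\to\mathbb{C}$ with $\|f\|_{\mu,1}=\int_{\mathbb{R}}|f(v)||v|^{2\mu+1}dv<\infty$. $\mathcal{C}_0(\mathbb{R})$ is the space of continuous functions on $\mathbb{R}$ vanishing at infinity, and $\|\cdot\|_\infty$ is the supremum norm. Put $c_\mu=\frac{1}{2^{\mu+1}\Gamma(\mu+1)}$. The normalized spherical Bessel function is $j_\mu(z)=\Gamma(\mu+1)\sum_{n=0}^{\infty}\frac{(-1)^n (z/2)^{2n}}{n!\,\Gamma(n+\mu+1)}$, and the Dunkl kernel is $E_\mu(iw,v)=j_\mu(wv)+\frac{iwv}{2(\mu+1)}\,j_{\mu+1}(wv)$ for $w,v\in\mathbb{R}$. For real $a,b,c,d,e$ with $b\neq0$, the quadratic-phase Dunkl kernel is $\Psi^{a,b,c}_{d,e,\mu}(w,v)=e^{-i(av^2+cw^2+dv+ew)}E_\mu(-iw/b,v)$, and the quadratic-phase Dunkl transform of $f\in L^1_\mu(\mathbb{R})$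 is $\mathcal{D}^{a,b,c}_{d,e,\mu}[f](w)=\frac{c_\mu}{(ib)^{\mu+1}}\int_{\mathbb{R}}\Psi^{a,b,c}_{d,e,\mu}(w,v)f(v)|v|^{2\mu+1}dv$. Complex powers are taken with the principal branch. *)

(* Defs.v *)
From mathcomp Require Import all_boot all_order all_algebra.
From mathcomp Require Import all_classical all_reals all_analysis.
From mathcomp Require Export complex.

Set Implicit Arguments.
Unset Strict Implicit.
Unset Printing Implicit Defensive.

Import Order.TTheory GRing.Theory Num.Theory.
Import numFieldNormedType.Exports.

Local Open Scope classical_set_scope.
Local Open Scope ring_scope.
Local Open Scope complex_scope.

Section ComplexValued.
Context {R : realType}.

(* The real-valued modulus; [`|z|] is the same number seen in [R[i]]. *)
Definition cmod (z : R[i]) : R := Normc.normc z.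

(* exp (i t) *)
Definition expi (t : R) : R[i] := cos t +i* sin t.

(* Principal argument of [z != 0], with values in ]-pi, pi]. *)
Definition carg (z : R[i]) : R :=
  if 0 <= complex.Im z then acos (complex.Re z / cmod z)
  else - acos (complex.Re z / cmod z).

(* z ^ s = exp (s (ln |z| + i arg z)), principal branch, for [z != 0]. *)
Definition cpowR (z : R[i]) (s : R) : R[i] :=
  (cmod z `^ s)%:C * expi (s * carg z).

Definition cmeasurable (f : R -> R[i]) : Prop :=
  measurable_fun setT (fun x => complex.Re (f x)) /\
  measurable_fun setT (fun x => complex.Im (f x)).

Definition cintegral (f : R -> R[i]) : R[i] :=
  (\int[lebesgue_measure]_x complex.Re (f x)) +i*
  (\int[lebesgue_measure]_x complex.Im (f x)).

(* [R[i]^o] is [R[i]] with the topology of its modulus. *)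
Definition inC0 (f : R -> R[i]) : Prop :=
  let g : R -> R[i]^o := f in
  [/\ continuous g, g @ +oo --> (0 : R[i]^o) & g @ -oo --> (0 : R[i]^o)].

(* Extended real, so that the norm of an unbounded function is [+oo]. *)
Definition supnorm (f : R -> R[i]) : \bar R :=
  ereal_sup (range (fun x => (cmod (f x))%:E)).

End ComplexValued.

Section QuadraticPhaseDunkl.
Context {R : realType}.
Implicit Types (a b c d e mu w v x z : R) (f : R -> R[i]).

(* Euler's integral: the Gamma function for [0 < x]. It is only used there,
   as [mu + 1 >= 1 / 2]. *)
Definition Gamma x : R :=
  \int[lebesgue_measure]_(t in `]0, +oo[) (t `^ (x - 1) * expR (- t)).

Definition bessel_term mu z (n : nat) : R :=
  (-1) ^+ n * (z / 2) ^+ n.*2 / (n`!%:R * Gamma (n%:R + mu + 1)).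

Definition besselj mu z : R :=
  Gamma (mu + 1) * limn (series (bessel_term mu z)).

(* [dunkl_kernel mu w v] is E_mu(i w, v). *)
Definition dunkl_kernel mu w v : R[i] :=
  besselj mu (w * v) +i*
  (w * v / (2 * (mu + 1)) * besselj (mu + 1) (w * v)).

Definition dunkl_weight mu v : R := `|v| `^ (2 * mu + 1).

Definition dunkl_cst mu : R := (2 `^ (mu + 1) * Gamma (mu + 1))^-1.

Definition L1norm mu f : \bar R :=
  (\int[lebesgue_measure]_v (cmod (f v) * dunkl_weight mu v)%:E)%E.

Definition inL1 mu f : Prop := cmeasurable f /\ (L1norm mu f < +oo)%E.

(* E_mu(- i w / b, v) = E_mu(i (- w / b), v) *)
Definition qpd_kernel a b c d e mu w v : R[i] :=
  expi (- (a * v ^+ 2 + c * w ^+ 2 + d * v + e * w)) *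
  dunkl_kernel mu (- w / b) v.

Definition qpd_transform a b c d e mu f w : R[i] :=
  (dunkl_cst mu)%:C / cpowR (0 +i* b) (mu + 1) *
  cintegral (fun v => qpd_kernel a b c d e mu w v * f v *
                      (dunkl_weight mu v)%:C).

End QuadraticPhaseDunkl.

(* Main.v *)
Require Import Defs.
From mathcomp Require Import all_boot all_order all_algebra.
From mathcomp Require Import all_classical all_reals all_analysis.
From mathcomp Require Import measurable_realfun ring lra.

Set Implicit Arguments.
Unset Strict Implicit.
Unset Printing Implicit Defensive.

Import Order.TTheory GRing.Theory Num.Theory.
Import numFieldNormedType.Exports.

Local Open Scope classical_set_scope.
Local Open Scope ring_scope.

(** The transform is an integral transform whose kernel has modulus at most
    one. Pull the chirps out: up to the constant
    [c_mu / (i b) ^ (mu + 1)], of modulus [c_mu / |b| ^ (mu + 1)], and a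
    unimodular factor depending on [w] only, its value at [w] is
    [G (- w / b)], where [G l] is the integral of [E_mu (i l, v) h v] and [h]
    is an integrable function with [|h v| = |f v| |v| ^ (2 mu + 1)].
    So it is enough to show that [|E_mu| <= 1] (hence the norm bound and, by
    dominated convergence, continuity) and that [G] vanishes at infinity.

    Both facts follow from a differential system rather than from an integral
    representation of the Bessel functions. With [k = 2 mu + 1 >= 0], write
    [E_mu (i l, v) = u x + i (x w x)] at [x = l v], where [u = j_mu] and
    [w = j_(mu+1) / (2 (mu + 1))]. The power series give
      [u' = - x w]   and   [(x w)' = u - k w],
    the second relation being the functional equation of the Gamma function.
    - Then [(u ^ 2 + (x w) ^ 2)' = - 2 k x w ^ 2], so that this sum, equal to
      one at the origin, never exceeds one ([besselj_sqr_le1]).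
    - Moreover [u] and [x w] have bounded antiderivatives: [- u] for the
      latter, and for [u] an odd function that, for [x >= 1], differs from
      [x w - k u / x] by one whose derivative is O(1 / x ^ 2)
      ([besselj_bounded_antiderivative]).
    A bounded continuous function with a bounded antiderivative satisfies the
    Riemann-Lebesgue lemma ([riemann_lebesgue]); this treats [mu = - 1/2], where
    the kernel is [exp (i x)] and does not decay, together with [mu > - 1/2].

    The Gamma function enters as Euler's integral, so its finiteness,
    positivity and functional equation are derived first. *)

(** * Integrating derivatives over segments *)

Section Calculus.
Context {R : realType}.
Local Notation mu := lebesgue_measure.
Implicit Types (F f : R -> R) (a b x : R).

Lemma pointwise_continuous_within f a b :
  (forall x, a <= x <= b -> {for x, continuous f}) ->
  {within `[a, b], continuous f}.
Proof.
move=> cf; apply: continuous_in_subspaceT => x; rewrite inE/= in_itv/=.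
exact: cf.
Qed.

Lemma continuous_integrable_segment f a b :
  (forall x, a <= x <= b -> {for x, continuous f}) ->
  mu.-integrable `[a, b] (EFin \o f).
Proof.
move=> cf; apply: continuous_compact_integrable; first exact: segment_compact.
exact: pointwise_continuous_within.
Qed.

Lemma is_derive_continuous f x (df : R) :
  is_derive x 1 f df -> {for x, continuous f}.
Proof.
by case=> + _ => /derivable1_diffP; exact: differentiable_continuous.
Qed.

Lemma Rintegral_is_derive F f a b : a <= b ->
  (forall x, a <= x <= b -> is_derive x 1 F (f x)) ->
  (forall x, a <= x <= b -> {for x, continuous f}) ->
  \int[mu]_(x in `[a, b]) f x = F b - F a.
Proof.
rewrite le_eqVlt => /predU1P[-> _ _|ab dF cf].
  by rewrite set_itv1 Rintegral_set1 subrr.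
have cF x : a <= x <= b -> {for x, continuous F}.
  by move=> /dF; exact: is_derive_continuous.
have aab : a <= a <= b by rewrite lexx ltW.
have abb : a <= b <= b by rewrite lexx ltW.
rewrite /Rintegral (@continuous_FTC2 _ f F) //.
- exact: pointwise_continuous_within.
- split.
  + move=> x; rewrite in_itv/= => /andP[ax xb].
    by have [] := dF x; rewrite ?ltW.
  + exact/cvg_at_right_filter/cF.
  + exact/cvg_at_left_filter/cF.
- move=> x; rewrite in_itv/= => /andP[ax xb].
  rewrite derive1E; have [|_ ->//] := dF x.
  by rewrite !ltW.
Qed.

End Calculus.

(** * Euler's integral for the Gamma function *)

Section GammaFunction.
Context {R : realType}.
Local Notation mu := lebesgue_measure.
Implicit Types (x y t : R) (n : nat).

Let gam x t : R := t `^ (x - 1) * expR (- t).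

(** This is [s <= expR s] at [s = t / y], raised to the power [y]. *)
Lemma powR_le_expR y t : 0 < y -> 0 <= t -> t `^ y <= y `^ y * expR t.
Proof.
move=> y0 t0.
have yt : t / y <= expR (t / y).
  by apply: le_trans (expR_ge1Dx _); rewrite lerDr.
have ty0 : 0 <= t / y by rewrite divr_ge0// ltW.
have := ge0_ler_powR (ltW y0) ty0 (expR_ge0 (t / y)) yt.
rewrite -expRM divfK ?gt_eqF// => le1.
have {1}-> : t = y * (t / y) by rewrite mulrC divfK ?gt_eqF.
by rewrite powRM ?(ltW y0)// ler_wpM2l// powR_ge0.
Qed.

Let a_ n : R := n.+1%:R^-1.
Let b_ n : R := n.+1%:R.

Let a_gt0 n : 0 < a_ n. Proof. by rewrite invr_gt0. Qed.

Let a_le_b n : a_ n <= b_ n.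
Proof.
rewrite /a_ /b_ (@le_trans _ _ 1)//; last by rewrite ler1n.
by rewrite invf_le1 ?ler1n.
Qed.

Let K n : set R := `[a_ n, b_ n]%classic.

Let bigcup_K : \bigcup_n K n = `]0, +oo[%classic.
Proof.
apply/seteqP; split => [t [n _]|t].
  rewrite /K/= !in_itv/= => /andP[ant _]; rewrite andbT.
  exact: lt_le_trans ant.
rewrite /= in_itv/= andbT => t0.
have [n _ /(_ n (leqnn n)) Hn] : \forall n \near \oo, t <= n%:R :> R.
  exact: nbhs_infty_ger.
have [m _ /(_ m (leqnn m)) Hm] : \forall n \near \oo, t^-1 <= n%:R :> R.
  exact: nbhs_infty_ger.
exists (maxn n m) => //; rewrite /K/= in_itv/= /a_ /b_; apply/andP; split.
  rewrite -[t]invrK lef_pV2 ?posrE ?invr_gt0// (le_trans Hm)//.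
  by rewrite ler_nat ltnW// ltnS leq_maxr.
by rewrite (le_trans Hn)// ler_nat ltnW// ltnS leq_maxl.
Qed.

Let gam_gt0 x t : 0 < t -> 0 < gam x t.
Proof. by move=> t0; rewrite mulr_gt0 ?powR_gt0 ?expR_gt0. Qed.

Let gam_continuous x t : 0 < t -> {for t, continuous (gam x)}.
Proof.
move=> t0; apply: continuousM.
  exact/is_derive_continuous/is_derive1_powR.
by apply: continuous_comp; [exact: opp_continuous|exact: continuous_expR].
Qed.

Let gam_K_continuous x n t : a_ n <= t <= b_ n -> {for t, continuous (gam x)}.
Proof. by move=> /andP[ant _]; apply: gam_continuous; exact: lt_le_trans ant. Qed.

Let gam_cvg x : (\int[mu]_(t in K n) (gam x t)%:E)%E @[n --> \oo] -->
  (\int[mu]_(t in `]0%R, +oo[) (gam x t)%:E)%E.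
Proof.
rewrite -bigcup_K; apply: ge0_nondecreasing_set_cvg_integral.
- move=> n m nm; apply/subsetPset/subset_itv; rewrite bnd_simp.
    by rewrite lef_pV2 ?posrE// ler_nat ltnS.
  by rewrite ler_nat ltnS.
- by move=> n; exact: measurable_itv.
- move=> n; apply: (measurable_int mu); apply: continuous_integrable_segment.
  exact: gam_K_continuous.
- move=> n t; rewrite /K/= in_itv/= => /andP[ant _]; rewrite lee_fin ltW//.
  by apply: gam_gt0; exact: lt_le_trans ant.
Qed.

(** The integrand is dominated by a multiple of the derivative of the bounded
    function [- (1 + t ^ x)^-1], which handles both endpoints at once. *)
Let gam_bounded x : 0 < x ->
  exists C : R, forall n, \int[mu]_(t in K n) gam x t <= C.
Proof.
move=> x0.
(* (1 + t ^ x) ^ 2 <= 2 + 2 t ^ (2 x), and both terms are O(exp t) *)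
pose C := 2 + 2 * (2 * x) `^ (2 * x).
have C0 : 0 < C by rewrite ltr_wpDr// mulr_ge0// powR_ge0.
pose g t := x * t `^ (x - 1) / (1 + t `^ x) ^+ 2.
have d0 t : 0 < 1 + t `^ x by rewrite ltr_wpDr// powR_ge0.
have dG t : 0 < t -> is_derive t 1 (fun t => - (1 + t `^ x)^-1) (g t).
  move=> t0.
  have dp := is_derive1_powR x t0.
  have d1 : is_derive t 1 (fun t => 1 + t `^ x) (x * t `^ (x - 1)).
    by have := is_deriveD (is_derive_cst (1 : R) t 1) dp; rewrite add0r.
  have d2 := is_deriveN (@is_deriveV _ (fun t => 1 + t `^ x) _ _ _
    (lt0r_neq0 (d0 t)) d1).
  apply: is_derive_eq.
  by rewrite /g /GRing.scale/=; field; rewrite gt_eqF.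
have gc t : 0 < t -> {for t, continuous g}.
  move=> t0; apply: continuousM.
    apply: continuousM; first exact: cst_continuous.
    exact/is_derive_continuous/is_derive1_powR.
  apply: continuousV; first by rewrite expf_neq0// gt_eqF.
  apply: (@continuous_comp _ _ _ (fun t => 1 + t `^ x) (fun s => s ^+ 2)).
    apply: continuousD; first exact: cst_continuous.
    exact/is_derive_continuous/is_derive1_powR.
  exact: exprn_continuous.
exists (C / x) => n.
have K0 t : a_ n <= t <= b_ n -> 0 < t.
  by move=> /andP[ant _]; exact: lt_le_trans ant.
have -> : C / x = C / x * 1 by rewrite mulr1.
apply: (@le_trans _ _ (\int[mu]_(t in K n) (C / x * g t))).
  apply: le_Rintegral => //.
  - exact: measurable_itv.
  - by apply: continuous_integrable_segment; exact: gam_K_continuous.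
  - apply: continuous_integrable_segment => t /K0 t0.
    by apply: continuousM; [exact: cst_continuous|exact: gc].
  - move=> t; rewrite /K/= in_itv/= => /K0 t0.
    rewrite /gam /g expRN.
    rewrite (_ : C / x * _ = t `^ (x - 1) * (C / (1 + t `^ x) ^+ 2)); last first.
      by field; rewrite !gt_eqF.
    rewrite ler_wpM2l ?powR_ge0// ler_pdivlMr ?exprn_gt0//.
    rewrite mulrC ler_pdivrMr ?expR_gt0//.
    have := @powR_le_expR (2 * x) t (mulr_gt0 (ltr0Sn _ 1) x0) (ltW t0).
    have -> : t `^ (2 * x) = (t `^ x) ^+ 2.
      by rewrite (mulrC 2) powRrM powR_mulrn ?powR_ge0.
    have e1 : 1 <= expR t by rewrite -expR0 ler_expR ltW.
    move=> h; rewrite /C; have := sqr_ge0 (1 - t `^ x).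
    by nra.
rewrite RintegralZl//.
- apply: ler_wpM2l; first by rewrite divr_ge0 ?ltW.
  have := Rintegral_is_derive (a_le_b n) (fun t ht => dG t (K0 t ht))
    (fun t ht => gc t (K0 t ht)).
  move=> /= ->.
  have : (1 + a_ n `^ x)^-1 <= 1 by rewrite invf_le1// lerDl powR_ge0.
  have : 0 <= (1 + b_ n `^ x)^-1 by rewrite invr_ge0 ltW.
  by lra.
- exact: measurable_itv.
- by apply: continuous_integrable_segment => t /K0 /gc.
Qed.

Let gam_integrable x : 0 < x -> mu.-integrable `]0, +oo[ (EFin \o gam x).
Proof.
move=> x0; have [C HC] := gam_bounded x0.
have mg : measurable_fun (`]0, +oo[ : set R) (gam x).
  apply: open_continuous_measurable_fun; first exact: interval_open.
  by move=> t; rewrite inE/= in_itv/= andbT; exact: gam_continuous.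
apply/integrableP; split; first exact/measurable_EFinP.
under eq_integral => t.
  rewrite inE/= in_itv/= andbT => t0.
  rewrite ger0_norm; last by rewrite ltW// gam_gt0.
  over.
apply: (@le_lt_trans _ _ C%:E); last exact: ltry.
have gcv := @gam_cvg x; rewrite -(cvg_lim _ gcv)//.
apply: lime_le; first by apply/cvg_ex; eexists; exact: gcv.
apply: nearW => n; rewrite -[leLHS]fineK; first by rewrite lee_fin; exact: HC.
apply: integrable_fin_num; first exact: measurable_itv.
by apply: continuous_integrable_segment; exact: gam_K_continuous.
Qed.

Let Rgam_cvg x : 0 < x ->
  \int[mu]_(t in K n) gam x t @[n --> \oo] --> Gamma x.
Proof.
move=> x0; apply: fine_cvg; rewrite fineK; first exact: gam_cvg.
apply: integrable_fin_num; first exact: measurable_itv.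
exact: gam_integrable.
Qed.

Let h x t : R := t `^ x * expR (- t).

Let h_b_cvg x : 0 < x -> h x (b_ n) @[n --> \oo] --> 0.
Proof.
move=> x0; pose C := (x + 1) `^ (x + 1).
apply: (@squeeze_cvgr _ _ _ _ (cst 0) (fun n => C * a_ n)).
- apply: nearW => n; rewrite /h mulr_ge0 ?powR_ge0 ?expR_ge0//=.
  have b0 : 0 < b_ n by [].
  (* the exponent x + 1 in place of x gains the factor 1 / t *)
  have x10 : 0 < x + 1 by rewrite addr_gt0.
  have := powR_le_expR x10 (ltW b0).
  rewrite -(mulr_powRB1 (ltW b0) x10) addrK => hb.
  by rewrite expRN ler_pdivrMr ?expR_gt0// mulrAC ler_pdivlMr// mulrC.
- exact: cvg_cst.
- by rewrite -(mulr0 C); apply: cvgM; [exact: cvg_cst|exact: cvg_harmonic].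
Qed.

Let h_a_cvg x : 0 < x -> h x (a_ n) @[n --> \oo] --> 0.
Proof.
move=> x0.
have h1 : a_ n `^ x @[n --> \oo] --> 0.
  by apply: (cvg_at_rightP _ _ _).1 (powR_cvg0 x0) _ _; split;
    [exact: a_gt0|exact: cvg_harmonic].
have h2 : expR (- a_ n) @[n --> \oo] --> expR (- 0).
  apply: (@cvg_comp _ _ _ (fun n => - a_ n) expR _ (nbhs (- 0 : R))).
    by apply: cvgN; exact: cvg_harmonic.
  exact: continuous_expR.
by rewrite -(mul0r (expR (- 0))); exact: cvgM.
Qed.

Lemma Gamma_gt0 x : 0 < x -> 0 < Gamma x.
Proof.
move=> x0.
have c12 t : 1 <= t <= 2 -> {for t, continuous (gam x)}.
  by move=> /andP[t1 _]; apply: gam_continuous; exact: lt_le_trans t1.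
have [c + Hc] := EVT_min (ler1n R 2) (pointwise_continuous_within c12).
rewrite in_itv/= => /andP[c1 _].
have gc0 : 0 < gam x c by apply: gam_gt0; exact: lt_le_trans c1.
apply: (lt_le_trans gc0).
have -> : gam x c = \int[mu]_(_ in `[1, 2]) gam x c.
  rewrite Rintegral_cst//= lebesgue_measure_itv/= lte_fin ltr1n/=.
  by rewrite -[X in _ * X]/(2 - 1) (_ : 2 - 1 = 1)// ?mulr1//; ring.
apply: (@le_trans _ _ (\int[mu]_(t in `[1, 2]) gam x t)).
  apply: le_Rintegral => //.
  - by apply: continuous_integrable_segment => t _; exact: cst_continuous.
  - exact: continuous_integrable_segment.
apply: fine_le.
- apply: integrable_fin_num => //.
  exact: continuous_integrable_segment.
- apply: integrable_fin_num => //.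
  exact: gam_integrable.
apply: ge0_subset_integral => //.
- exact: measurable_int (gam_integrable x0).
- move=> t; rewrite /= in_itv/= andbT => t0.
  by rewrite lee_fin ltW// gam_gt0.
- move=> t; rewrite /= !in_itv/= andbT => /andP[t1 _].
  exact: lt_le_trans t1.
Qed.

(** Integration by parts on the segments [K n]; the boundary terms tend to
    zero at both ends. *)
Lemma GammaS x : 0 < x -> Gamma (x + 1) = x * Gamma x.
Proof.
move=> x0.
have ibp n : x * \int[mu]_(t in K n) gam x t -
    \int[mu]_(t in K n) gam (x + 1) t = h x (b_ n) - h x (a_ n).
  have K0 t : a_ n <= t <= b_ n -> 0 < t.
    by move=> /andP[ant _]; exact: lt_le_trans ant.
  have ig y : mu.-integrable (K n) (EFin \o gam y).
    by apply: continuous_integrable_segment; exact: gam_K_continuous.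
  have cx t : a_ n <= t <= b_ n -> {for t, continuous (fun t => x * gam x t)}.
    move=> /gam_K_continuous gc.
    by apply: continuousM; [exact: cst_continuous|exact: gc].
  rewrite -RintegralZl//; last exact: measurable_itv.
  rewrite -RintegralB//; last 2 first.
    exact: measurable_itv.
    exact: continuous_integrable_segment.
  apply: (@Rintegral_is_derive _ (h x)); first exact: a_le_b.
  - move=> t /K0 t0.
    have de : is_derive t 1 (fun t => expR (- t)) (- expR (- t)).
      have := @is_derive1_comp _ expR (fun s => - s) t _ _ (is_derive_expR _)
        (is_deriveN (is_derive_id t 1)).
      by rewrite mulrN1.
    apply: (is_derive_eq (is_deriveM (is_derive1_powR x t0) de)).
    by rewrite /gam /GRing.scale/= addrK; ring.
  - move=> t ht; apply: continuousB; first exact: cx.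
    exact: gam_K_continuous ht.
apply/eqP; rewrite eq_sym -subr_eq0; apply/eqP.
have x10 : 0 < x + 1 by rewrite addr_gt0.
have c1 : x * \int[mu]_(t in K n) gam x t - \int[mu]_(t in K n) gam (x + 1) t
    @[n --> \oo] --> x * Gamma x - Gamma (x + 1).
  apply: cvgB; last exact: Rgam_cvg.
  by apply: cvgM; [exact: cvg_cst|exact: Rgam_cvg].
have c2 : h x (b_ n) - h x (a_ n) @[n --> \oo] --> 0 - 0.
  by apply: cvgB; [exact: h_b_cvg|exact: h_a_cvg].
rewrite subr0 in c2.
rewrite -(cvg_lim _ c1)//; under eq_fun do rewrite /= ibp.
exact: cvg_lim c2.
Qed.

End GammaFunction.

(** * Power series with coefficients O(1 / n!) *)

Section EntireSeries.
Context {R : realType}.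
Implicit Types (c : nat -> R) (x y : R).

Definition factorially_bounded c :=
  exists M : R, forall n, `|c n| <= M / n`!%:R.

Definition psum c y : R := limn (pseries c y).

Lemma factorially_bounded_cvg c y :
  factorially_bounded c -> cvgn (pseries c y).
Proof.
move=> [M cM]; apply: normed_cvg; rewrite /normed_series_of/=.
apply: (@series_le_cvg _ _ (fun n => M * exp_coeff `|y| n)) => [//|n|n|].
- apply: mulr_ge0; last by rewrite exp_coeff_ge0.
  by have := le_trans (normr_ge0 _) (cM 0%N); rewrite fact0 divr1.
- rewrite normrM normrX /exp_coeff/= mulrCA mulrC.
  by rewrite ler_wpM2l ?exprn_ge0.
- have := @is_cvg_seriesZ _ _ M (is_cvg_series_exp_coeff `|y|).
  by apply.
Qed.

Lemma factorially_bounded_diffs c :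
  factorially_bounded c -> factorially_bounded (pseries_diffs c).
Proof.
move=> [M cM]; exists M => n.
rewrite /pseries_diffs normrM normr_nat.
apply: (le_trans (ler_wpM2l (ler0n _ _) (cM n.+1))).
by rewrite factS natrM invfM mulrCA mulVKf ?pnatr_eq0.
Qed.

Lemma is_derive_psum c y : factorially_bounded c ->
  is_derive y 1 (psum c) (psum (pseries_diffs c) y).
Proof.
move=> cb; have db := factorially_bounded_diffs cb.
have ddb := factorially_bounded_diffs db.
apply: (@pseries_snd_diffs _ _ (`|y| + 1)); try exact: factorially_bounded_cvg.
by rewrite [ltRHS]ger0_norm ?ltrDl// addr_ge0.
Qed.

Lemma psumZ c a y : factorially_bounded c ->
  psum (fun n => a * c n) y = a * psum c y.
Proof.
move=> cb; apply: cvg_lim => //.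
have -> : pseries (fun n => a * c n) y = (fun n => a * pseries c y n).
  apply/funext => n; rewrite /pseries /series/= mulr_sumr.
  by apply: eq_bigr => i _; rewrite mulrA.
by apply: cvgM; [exact: cvg_cst|exact: factorially_bounded_cvg].
Qed.

Lemma psum_at0 c : psum c 0 = c 0%N.
Proof.
apply: lim_near_cst => //; near=> n.
rewrite /pseries /series/= -(@prednK n); last by near: n; exact: nbhs_infty_gt.
rewrite big_nat_recl//= expr0 mulr1 big1 ?addr0// => i _.
by rewrite expr0n mulr0.
Unshelve. all: by end_near. Qed.

(** The Euler operator [y d/dy] multiplies the n-th coefficient by [n]; a
    proportionality between [(n + al) c_n] and [d_n] is therefore a first
    order differential relation between the two sums. *)
Lemma psum_euler c d al be y :
  factorially_bounded c -> factorially_bounded d ->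
  (forall n, (n%:R + al) * c n = be * d n) ->
  al * psum c y + y * psum (pseries_diffs c) y = be * psum d y.
Proof.
move=> cb db cd.
have c1 : al * pseries c y n +
    y * series (fun i => i%:R * c i * y ^+ i.-1) n @[n --> \oo] -->
    al * psum c y + y * psum (pseries_diffs c) y.
  apply: cvgD; apply: cvgM; try exact: cvg_cst.
    exact: factorially_bounded_cvg.
  apply: pseries_diffs_equiv; apply: factorially_bounded_cvg.
  exact: factorially_bounded_diffs.
rewrite -(cvg_lim _ c1)//; apply: cvg_lim => //.
rewrite [X in X @ _ --> _](_ : _ = (fun n => be * pseries d y n)).
  by apply: cvgM; [exact: cvg_cst|exact: factorially_bounded_cvg].
apply/funext => n; rewrite /pseries /series/= !mulr_sumr -big_split/=.
apply: eq_bigr => -[|i] _.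
  by have := cd 0%N; rewrite !mul0r mulr0 addr0 expr0 !mulr1 add0r.
by rewrite [RHS]mulrA -cd/= exprS; ring.
Qed.

End EntireSeries.

(** * The spherical Bessel functions as power series in the squared variable *)

Section BesselSeries.
Context {R : realType}.
Implicit Types (m x y z : R).

(** Coefficients of [besselj m / Gamma (m + 1)] as a series in [z ^+ 2]. *)
Definition bessel_coef m n : R :=
  (- 4^-1) ^+ n / (n`!%:R * Gamma (n%:R + m + 1)).

Lemma besseljE m z :
  besselj m z = Gamma (m + 1) * psum (bessel_coef m) (z ^+ 2).
Proof.
rewrite /besselj /psum /pseries; congr (_ * _).
suff -> : bessel_term m z = (fun n => bessel_coef m n * (z ^+ 2) ^+ n) by [].
apply/funext => n; rewrite /bessel_term /bessel_coef -mul2n exprM.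
rewrite -exprMn [RHS]mulrAC -exprMn; congr (_ ^+ _ / _).
by field.
Qed.

(** Only the first step of the recursion can decrease the value, and then by
    the factor [m + 1 >= 1 / 2]. *)
Lemma Gamma_shift_ge m n : - 2^-1 <= m ->
  Gamma (m + 1) / 2 <= Gamma (n%:R + m + 1).
Proof.
move=> hm; have m10 : 0 < m + 1 by lra.
have G0 := Gamma_gt0 m10.
elim: n => [|[|n] IH]; first by rewrite add0r; lra.
- rewrite (_ : 1%:R + m + 1 = m + 1 + 1); last by ring.
  by rewrite (GammaS m10); nra.
- have n0 : 0 <= n%:R :> R by [].
  have n10 : 1 <= n.+1%:R + m + 1 by rewrite -natr1; lra.
  rewrite (_ : n.+2%:R + m + 1 = n.+1%:R + m + 1 + 1); last first.
    by rewrite -[n.+2%:R]natr1; ring.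
  rewrite [leRHS]GammaS; last exact: lt_le_trans n10.
  by apply: (le_trans IH); rewrite ler_peMl// (le_trans _ IH)// divr_ge0 ?ltW.
Qed.

Lemma bessel_coef_bounded m : - 2^-1 <= m ->
  factorially_bounded (bessel_coef m).
Proof.
move=> hm; have m10 : 0 < m + 1 by lra.
have G0 := Gamma_gt0 m10; have G20 : 0 < Gamma (m + 1) / 2 by rewrite divr_gt0.
exists (Gamma (m + 1) / 2)^-1 => n.
have Gn := lt_le_trans G20 (Gamma_shift_ge n hm).
rewrite /bessel_coef normrM normrX normfV normrM normr_nat invfM.
rewrite [leLHS]mulrCA [leRHS]mulrC ler_wpM2l//.
rewrite (gtr0_norm Gn) -[leRHS]mul1r ler_pM//.
- by rewrite invr_ge0 ltW.
- by rewrite normrN exprn_ile1// ger0_norm//; lra.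
- by rewrite lef_pV2 ?posrE// Gamma_shift_ge.
Qed.

Lemma pseries_diffs_bessel_coef m :
  pseries_diffs (bessel_coef m) = (fun n => - 4^-1 * bessel_coef (m + 1) n).
Proof.
apply/funext => n; rewrite /pseries_diffs /bessel_coef exprS factS natrM.
rewrite (_ : n.+1%:R + m + 1 = n%:R + (m + 1) + 1); last first.
  by rewrite -[n.+1%:R]natr1; ring.
have n0 : n.+1%:R * n.+1%:R^-1 = 1 :> R by rewrite mulfV ?pnatr_eq0.
rewrite !invfM; move: (Gamma _)^-1 n.+1%:R^-1 n`!%:R^-1 n0 => G i f n0.
transitivity (n.+1%:R * i * (- 4^-1 * ((- 4^-1) ^+ n * (f * G)))).
  by ring.
by rewrite n0 mul1r.
Qed.

Lemma bessel_coefS m n : - 2^-1 <= m ->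
  (n%:R + (m + 1)) * bessel_coef (m + 1) n = bessel_coef m n.
Proof.
move=> hm; have n0 : 0 <= n%:R :> R by [].
rewrite /bessel_coef.
have p0 : 0 < n%:R + m + 1 by lra.
rewrite (_ : n%:R + (m + 1) = n%:R + m + 1) ?addrA// GammaS//.
have f0 : n`!%:R != 0 :> R by rewrite pnatr_eq0 -lt0n fact_gt0.
by field; rewrite f0 !gt_eqF// ?Gamma_gt0//; lra.
Qed.

End BesselSeries.

(** * The Bessel differential system *)

Section DerivativeTools.
Context {R : realType}.
Implicit Types (F f : R -> R) (a x y : R).

Lemma is_derive_ge0_ndecr F f a :
  (forall x, a <= x -> is_derive x 1 F (f x)) ->
  (forall x, a <= x -> 0 <= f x) ->
  forall x y, a <= x -> x <= y -> F x <= F y.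
Proof.
move=> dF f0; apply: ger0_derive1_ndecry => [x|x|].
- by rewrite in_itv/= andbT => /ltW/dF[].
- by rewrite in_itv/= andbT derive1E => /ltW ax; have [_ ->] := dF _ ax; exact: f0.
- apply: continuous_in_subspaceT => x; rewrite inE/= in_itv/= andbT => /dF.
  exact: is_derive_continuous.
Qed.

Lemma is_derive_le0_nincr F f a :
  (forall x, a <= x -> is_derive x 1 F (f x)) ->
  (forall x, a <= x -> f x <= 0) ->
  forall x y, a <= x -> x <= y -> F y <= F x.
Proof.
move=> dF f0 x y ax xy; rewrite -lerN2.
apply: (@is_derive_ge0_ndecr (fun t => - F t) (fun t => - f t) a) => // t at_.
  exact: is_deriveN (dF t at_).
by rewrite oppr_ge0 f0.
Qed.

Lemma is_derive_mulfun f g x (a b : R) :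
  is_derive x 1 f a -> is_derive x 1 g b ->
  is_derive x 1 (fun t => f t * g t) (a * g x + f x * b).
Proof.
move=> df dg; apply: (is_derive_eq (is_deriveM df dg)).
by rewrite /GRing.scale/= addrC mulrC.
Qed.

Lemma is_derive_cstmul f x (a b : R) :
  is_derive x 1 f a -> is_derive x 1 (fun t => b * f t) (b * a).
Proof.
move=> df; apply: (is_derive_eq (is_derive_mulfun (is_derive_cst b x 1) df)).
by rewrite mul0r add0r.
Qed.

Lemma is_derive_psum_sqr (c : nat -> R) x : factorially_bounded c ->
  is_derive x 1 (fun t => psum c (t ^+ 2))
    (2 * x * psum (pseries_diffs c) (x ^+ 2)).
Proof.
move=> cb.
have d2 : is_derive x 1 (fun t : R => t ^+ 2) (2 * x).
  apply: (is_derive_eq (is_derive_mulfun (is_derive_id x 1) (is_derive_id x 1))).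
  by ring.
rewrite mulrC.
exact: (@is_derive1_comp _ (psum c) (fun t => t ^+ 2) x _ _
  (is_derive_psum _ cb) d2).
Qed.

End DerivativeTools.

Section BesselODE.
Context {R : realType}.
Variable m : R.
Hypothesis hm : - 2^-1 <= m.
Implicit Types x y : R.

Let m1 : - 2^-1 <= m + 1. Proof. by move: hm; lra. Qed.
Let m10 : 0 < m + 1. Proof. by move: hm; lra. Qed.
Let k_ge0 : 0 <= 2 * m + 1. Proof. by move: hm; lra. Qed.
Let G0 := Gamma_gt0 m10.
Let C_bounded := bessel_coef_bounded hm.
Let C1_bounded := bessel_coef_bounded m1.

Let w x : R := besselj (m + 1) x / (2 * (m + 1)).

Let wE x : w x = Gamma (m + 1) / 2 * psum (bessel_coef (m + 1)) (x ^+ 2).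
Proof. by rewrite /w besseljE (GammaS m10); field; rewrite gt_eqF. Qed.

Lemma besselj_even x : besselj m (- x) = besselj m x.
Proof. by rewrite !besseljE sqrrN. Qed.

Lemma besselj0 : besselj m 0 = 1.
Proof.
rewrite besseljE expr0n/= psum_at0 /bessel_coef expr0 fact0 mul1r mul1r add0r.
by rewrite mulfV// gt_eqF.
Qed.

Lemma is_derive_besselj x : is_derive x 1 (besselj m) (- (x * w x)).
Proof.
rewrite (_ : besselj m = fun x => Gamma (m + 1) * psum (bessel_coef m) (x ^+ 2)).
  apply: (is_derive_eq (is_derive_cstmul _ (is_derive_psum_sqr x C_bounded))).
  by rewrite pseries_diffs_bessel_coef psumZ// wE; field.
by apply/funext => t; rewrite besseljE.
Qed.

(** Differentiating [w] shifts the coefficients; the Euler operator shifts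
    them back, which brings out [besselj m] and the friction term. *)
Lemma is_derive_mul_besselj x :
  is_derive x 1 (fun t => t * w t) (besselj m x - (2 * m + 1) * w x).
Proof.
rewrite (_ : (fun t => t * w t) = fun t => t *
    (Gamma (m + 1) / 2 * psum (bessel_coef (m + 1)) (t ^+ 2))).
  apply: (is_derive_eq (is_derive_mulfun (is_derive_id x 1)
    (is_derive_cstmul _ (is_derive_psum_sqr x C1_bounded)))).
  have := @psum_euler _ _ _ (m + 1) 1 (x ^+ 2) C1_bounded C_bounded.
  rewrite mul1r besseljE wE => <-; first by field.
  by move=> n; rewrite mul1r bessel_coefS.
by apply/funext => t; rewrite wE.
Qed.

(** Dunkl's equation makes [j ^ 2 + (x w) ^ 2] decrease away from the origin:
    the rotation part of the system preserves it and the term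
    [(2 m + 1) / x] is a friction. *)
Lemma besselj_sqr_le1 x : besselj m x ^+ 2 + (x * w x) ^+ 2 <= 1.
Proof.
wlog x0 : x / 0 <= x => [H|].
  have [/H//|/ltW x0] := leP 0 x.
  have := H (- x); rewrite oppr_ge0 => /(_ x0).
  by rewrite besselj_even !wE sqrrN mulNr sqrrN.
pose L t := besselj m t * besselj m t + (t * w t) * (t * w t).
suff : L x <= L 0 by rewrite /L besselj0 !mul0r addr0 mulr1 -!expr2.
apply: (@is_derive_le0_nincr _ _ (fun t => - 2 * (2 * m + 1) * (t * w t ^+ 2)) 0)
  => // t t0.
  apply: (is_derive_eq (is_deriveD
    (is_derive_mulfun (is_derive_besselj t) (is_derive_besselj t))
    (is_derive_mulfun (is_derive_mul_besselj t) (is_derive_mul_besselj t)))).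
  by ring.
rewrite !mulNr oppr_le0; apply: mulr_ge0; first exact: mulr_ge0.
by apply: mulr_ge0; last exact: sqr_ge0.
Qed.

Lemma besselj_le1 x : `|besselj m x| <= 1.
Proof.
rewrite -(@ler_pXn2r _ 2)// ?nnegrE// expr1n real_normK ?num_real//.
by apply: le_trans (besselj_sqr_le1 x); rewrite lerDl sqr_ge0.
Qed.

Lemma mul_besselj_le1 x : `|x * w x| <= 1.
Proof.
rewrite -(@ler_pXn2r _ 2)// ?nnegrE// expr1n real_normK ?num_real//.
by apply: le_trans (besselj_sqr_le1 x); rewrite lerDr sqr_ge0.
Qed.

(* Phi is the termwise antiderivative of besselj m. *)
Let q n : R := bessel_coef m n / (n%:R * 2 + 1).
Let Phi x : R := x * (Gamma (m + 1) * psum q (x ^+ 2)).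

Let q_bounded : factorially_bounded q.
Proof.
have [M CM] := C_bounded; exists M => n; apply: le_trans (CM n).
have n0 : 0 <= n%:R :> R by [].
rewrite /q normrM ler_piMr// normfV gtr0_norm; last by lra.
by rewrite invf_le1; lra.
Qed.

Let is_derive_Phi x : is_derive x 1 Phi (besselj m x).
Proof.
apply: (is_derive_eq (is_derive_mulfun (is_derive_id x 1)
    (is_derive_cstmul _ (is_derive_psum_sqr x q_bounded)))).
have := @psum_euler _ q _ 2^-1 2^-1 (x ^+ 2) q_bounded C_bounded.
rewrite besseljE => H; rewrite -[psum (bessel_coef m) _](@mulVKf _ 2)//.
rewrite -H; first by field.
move=> n; have n0 : 0 <= n%:R :> R by [].
by rewrite /q; field; rewrite gt_eqF//; lra.
Qed.

(** Integrating [j = (x w)' + (2 m + 1) w] and [(j / x)' = - w - j / x ^ 2]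
    leaves only the integrable error [(2 m + 1) j / x ^ 2]. *)
Lemma besselj_bounded_antiderivative : exists F : R -> R, exists M : R,
  (forall x, is_derive x 1 F (besselj m x)) /\ (forall x, `|F x| <= M).
Proof.
pose k := 2 * m + 1; have k0 : 0 <= k by [].
(* H' = - k j / x ^ 2 lies between the derivatives of k / x and - k / x. *)
pose H x := Phi x - x * w x + k * (besselj m x * x^-1).
have dinv x : 1 <= x -> is_derive x 1 (fun t : R => t^-1) (- x^-1 ^+ 2).
  move=> x1; have x0 : x != 0 by rewrite gt_eqF// (lt_le_trans _ x1).
  apply: (is_derive_eq (@is_deriveV _ id x _ _ x0 (is_derive_id x 1))).
  by rewrite /GRing.scale/= mulr1 exprVn.
have dH x : 1 <= x -> is_derive x 1 H (- k * besselj m x * x^-1 ^+ 2).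
  move=> x1; have x0 : x != 0 by rewrite gt_eqF// (lt_le_trans _ x1).
  apply: (is_derive_eq (is_deriveD
    (is_deriveB (is_derive_Phi x) (is_derive_mul_besselj x))
    (is_derive_cstmul k (is_derive_mulfun (is_derive_besselj x) (dinv x x1))))).
  by rewrite /k; field.
have Hge x : 1 <= x -> H 1 - k <= H x - k * x^-1.
  move=> x1.
  suff : H 1 - k * 1^-1 <= H x - k * x^-1 by rewrite invr1 mulr1.
  apply: (@is_derive_ge0_ndecr _ (fun t => H t - k * t^-1)
    (fun t => k * (1 - besselj m t) * t^-1 ^+ 2) 1) => // t t1.
    apply: (is_derive_eq (is_deriveB (dH t t1) (is_derive_cstmul k (dinv t t1)))).
    by ring.
  rewrite mulr_ge0 ?sqr_ge0// mulr_ge0// subr_ge0.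
  by have := besselj_le1 t; rewrite ler_norml => /andP[].
have Hle x : 1 <= x -> H x + k * x^-1 <= H 1 + k.
  move=> x1.
  suff : H x + k * x^-1 <= H 1 + k * 1^-1 by rewrite invr1 mulr1.
  apply: (@is_derive_le0_nincr _ (fun t => H t + k * t^-1)
    (fun t => - (k * (1 + besselj m t) * t^-1 ^+ 2)) 1) => // t t1.
    apply: (is_derive_eq (is_deriveD (dH t t1) (is_derive_cstmul k (dinv t t1)))).
    by ring.
  rewrite oppr_le0 mulr_ge0 ?sqr_ge0// mulr_ge0//.
  by have := besselj_le1 t; rewrite ler_norml => /andP[]; lra.
exists Phi, (`|H 1| + 2 * k + 1); split; first exact: is_derive_Phi.
move=> x; wlog x0 : x / 0 <= x => [P|].
  have [/P//|/ltW x0] := leP 0 x.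
  by have := P (- x); rewrite oppr_ge0 => /(_ x0); rewrite /Phi sqrrN mulNr normrN.
have [x1|/ltW x1] := leP 1 x.
  have := Hge x x1; have := Hle x x1.
  have xi0 : 0 <= x^-1 by rewrite invr_ge0 (le_trans _ x1).
  have kx : 0 <= k * x^-1 by rewrite mulr_ge0.
  have : `|k * (besselj m x * x^-1)| <= k.
    rewrite normrM normrM (ger0_norm k0) (ger0_norm xi0) ler_piMr//.
    apply: mulr_ile1 => //; first exact: besselj_le1.
    by rewrite invf_le1// (lt_le_trans _ x1).
  have := mul_besselj_le1 x; have := ler_norm (H 1); have := ler_norm (- H 1).
  rewrite normrN !ler_norml /H => ? ? /andP[? ?] /andP[? ?] ? ?.
  by apply/andP; split; lra.
have [//|c _] := MVT_segment x0 (fun t _ => is_derive_Phi t).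
  by apply: pointwise_continuous_within => t _; exact/is_derive_continuous/is_derive_Phi.
rewrite {2}/Phi mul0r !subr0 => ->; rewrite normrM (ger0_norm x0).
apply: (@le_trans _ _ 1); first by rewrite mulr_ile1 ?besselj_le1.
by rewrite lerDr addr_ge0// mulr_ge0.
Qed.

End BesselODE.

(** * The Riemann-Lebesgue lemma for a bounded oscillating function *)

Section RiemannLebesgue.
Context {R : realType}.
Local Notation mu := (@lebesgue_measure R).
Implicit Types (g P : R -> R) (a b e l t x y : R).

(** Compactness of the segment in its near-covering form: the radius [d] runs
    along the filter of positive reals tending to zero. *)
Lemma continuous_segment_uniform g a b e : continuous g -> 0 < e ->
  exists2 d : R, 0 < d &
    forall x y, a <= x <= b -> `|x - y| < d -> `|g x - g y| <= e.
Proof.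
move=> cg e0.
have := @segment_compact R a b; move/compact_near_coveringP.
move=> /(_ _ (0^'+) (fun d x => forall y, `|x - y| < d -> `|g x - g y| <= e)).
case.
  move=> x _.
  have e20 : 0 < e / 2 by rewrite divr_gt0.
  have /cvgrPdist_lt/(_ _ e20)[d /= d0 gd] := cg x.
  exists (ball x (d / 2), [set u | u < d / 2]) => /=.
    split; first by apply: nbhsx_ballx; rewrite divr_gt0.
    by apply: nbhs_right_lt; rewrite divr_gt0.
  move=> [x' u]/= [xx' ud] y x'y.
  have {}xx' : `|x - x'| < d / 2 by exact: xx'.
  have {}ud : u < d / 2 by exact: ud.
  have h1 := gd x' _; have h2 := gd y _.
  have {}h1 : `|g x - g x'| < e / 2.
    by apply: h1; rewrite /ball/= (lt_trans xx')// ltr_pdivrMr// ltr_pMr// ltr1n.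
  have {}h2 : `|g x - g y| < e / 2.
    apply: h2; rewrite /ball/=.
    have := ler_distD x' x y; lra.
  have := ler_distD (g x) (g x') (g y); rewrite (distrC (g x') (g x)); lra.
move=> d /= d0 Hd; exists (d / 2); first by rewrite divr_gt0.
move=> x y xab xy.
apply: (Hd (d / 2)) xy => /=.
- by rewrite sub0r normrN gtr0_norm ?divr_gt0// ltr_pdivrMr// ltr_pMr// ltr1n.
- by rewrite divr_gt0.
- by rewrite in_itv.
Qed.

Lemma integrable_mul_bounded g P (D : set (measurableTypeR R)) : measurable D ->
  measurable_fun D g -> (forall x, `|g x| <= 1) ->
  mu.-integrable D (EFin \o P) ->
  mu.-integrable D (EFin \o (fun x => g x * P x)).
Proof.
move=> mD mg g1 iP. apply: (le_integrable mD _ _ iP) => //.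
  apply/measurable_EFinP/measurable_funM => //.
  by apply/measurable_EFinP; exact: measurable_int iP.
by move=> x _ /=; rewrite lee_fin normrM ler_piMl.
Qed.

Lemma integrable_tail P e : mu.-integrable setT (EFin \o P) -> 0 < e ->
  exists a : R, 0 <= a /\ \int[mu]_(t in ~` `[- a, a]) `|P t| <= e.
Proof.
move=> iP e0; pose D n : set (measurableTypeR R) := `[- n%:R, n%:R]%classic.
have iaP : mu.-integrable setT (EFin \o (fun t => `|P t|)) := integrable_abse iP.
have bigD : \bigcup_n D n = setT.
  apply/seteqP; split => // t _.
  have [n _ /(_ n (leqnn n)) Hn] : \forall n \near \oo, `|t| <= n%:R :> R.
    exact: nbhs_infty_ger.
  by exists n => //; rewrite /D/= in_itv/= -ler_norml.
have cD : (\int[mu]_(t in D n) `|P t|%:E)%E @[n --> \oo] -->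
    (\int[mu]_t `|P t|%:E)%E.
  rewrite -bigD; apply: ge0_nondecreasing_set_cvg_integral.
  - move=> n m nm; apply/subsetPset/subset_itv; rewrite bnd_simp.
      by rewrite lerN2 ler_nat.
    by rewrite ler_nat.
  - by move=> n; exact: measurable_itv.
  - move=> n; apply: measurable_funTS; exact: measurable_int iaP.
  - by move=> n t _; rewrite lee_fin.
have {}cD : \int[mu]_(t in D n) `|P t| @[n --> \oo] --> \int[mu]_t `|P t|.
  by apply: fine_cvg; rewrite fineK//; exact: integrable_fin_num.
move/cvgrPdist_le : cD => /(_ _ e0)[n _ /(_ n (leqnn n))] Dn.
exists n%:R; split => //.
have mD : measurable (D n) by exact: measurable_itv.
have : \int[mu]_t `|P t| =
    \int[mu]_(t in D n) `|P t| + \int[mu]_(t in ~` D n) `|P t|.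
  rewrite -[X in Rintegral _ X](setUv (D n)) Rintegral_setU ?setUv//.
    exact: measurableC.
  by apply/disj_setPS => t []; exact.
move=> E; move: Dn; rewrite E addrC addKr => Dn.
by apply: le_trans Dn; exact: ler_norm.
Qed.

Variables (phi Phi : R -> R) (M : R).
Hypothesis phi_cont : continuous phi.
Hypothesis phi_le1 : forall x, `|phi x| <= 1.
Hypothesis dPhi : forall x, is_derive x 1 Phi (phi x).
Hypothesis Phi_le : forall x, `|Phi x| <= M.

Let phi_l_cont l : continuous (fun t => phi (l * t)).
Proof.
move=> t; apply: (@continuous_comp _ _ _ (fun t => l * t) phi).
  by apply: continuousM; [exact: cst_continuous|exact: id].
exact: phi_cont.
Qed.

Let M_ge0 : 0 <= M. Proof. exact: le_trans (normr_ge0 _) (Phi_le 0). Qed.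

Let oscillation_itv a b l : a <= b -> l != 0 ->
  `|\int[mu]_(t in `[a, b]) phi (l * t)| <= 2 * M / `|l|.
Proof.
move=> ab l0.
have -> : \int[mu]_(t in `[a, b]) phi (l * t) =
    l^-1 * Phi (l * b) - l^-1 * Phi (l * a).
  apply: (@Rintegral_is_derive _ (fun t => l^-1 * Phi (l * t))) => // [t _|t _].
    apply: (is_derive_eq (is_derive_cstmul l^-1 (@is_derive1_comp _ Phi
      (fun t => l * t) t _ _ (dPhi _) (is_derive_cstmul l (is_derive_id t 1))))).
    by rewrite mulr1 mulrCA mulVf ?mulr1.
  exact: phi_l_cont.
rewrite -mulrBr normrM normfV mulrC ler_wpM2r ?invr_ge0//.
apply: (le_trans (ler_normB _ _)).
by have := Phi_le (l * b); have := Phi_le (l * a); lra.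
Qed.

Let piece g x d e B l : continuous g -> 0 <= d -> l != 0 ->
  (forall t, x <= t <= x + d -> `|g x - g t| <= e) -> `|g x| <= B ->
  `|\int[mu]_(t in `[x, x + d]) (phi (l * t) * g t)| <=
    e * d + B * (2 * M / `|l|).
Proof.
move=> cg d0 l0 gx gB.
have xd : x <= x + d by rewrite lerDl.
have i1 : mu.-integrable `[x, x + d]
    (EFin \o (fun t => phi (l * t) * (g t - g x))).
  apply: continuous_integrable_segment => t _.
  apply: continuousM; first exact: phi_l_cont.
  by apply: continuousB; [exact: cg|exact: cst_continuous].
have i2 : mu.-integrable `[x, x + d] (EFin \o (fun t => phi (l * t))).
  by apply: continuous_integrable_segment => t _; exact: phi_l_cont.
have i3 : mu.-integrable `[x, x + d] (EFin \o (fun t => g x * phi (l * t))).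
  apply: continuous_integrable_segment => t _.
  by apply: continuousM; [exact: cst_continuous|exact: phi_l_cont].
under eq_Rintegral => t _.
  rewrite (_ : phi (l * t) * g t =
    phi (l * t) * (g t - g x) + g x * phi (l * t)); last by ring.
  over.
rewrite RintegralD// RintegralZl//.
apply: (le_trans (ler_normD _ _)); apply: lerD; last first.
  by rewrite normrM ler_pM// oscillation_itv.
apply: (le_trans (le_normr_Rintegral _ i1)) => //.
apply: (@le_trans _ _ (\int[mu]_(_ in `[x, x + d]) e)).
  apply: le_Rintegral => //.
  - apply: continuous_integrable_segment => t _.
    apply: (@continuous_comp _ _ _ (fun t => phi (l * t) * (g t - g x))
      (fun u : R => `|u|)).
      apply: continuousM; first exact: phi_l_cont.
      by apply: continuousB; [exact: cg|exact: cst_continuous].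
    exact: norm_continuous.
  - by apply: continuous_integrable_segment => t _; exact: cst_continuous.
  - move=> t; rewrite /= in_itv/= => xt; rewrite normrM.
    by rewrite -[leRHS]mul1r ler_pM// distrC gx.
rewrite Rintegral_cst//= lebesgue_measure_itv/= lte_fin.
have e0 : 0 <= e by apply: le_trans (normr_ge0 _) (gx x _); rewrite lexx.
by case: ifPn => _ /=; [rewrite (addrC x) addrK|rewrite mulr0 mulr_ge0].
Qed.

(* Cutting into short segments, where g is almost constant, costs a fixed
   number of oscillation terms of size O(1 / |l|). *)
Let pieces g a d e B l n : continuous g -> 0 <= d -> l != 0 ->
  (forall x t, a <= x <= a + n%:R * d -> x <= t <= x + d -> `|g x - g t| <= e) ->
  (forall x, a <= x <= a + n%:R * d -> `|g x| <= B) ->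
  `|\int[mu]_(t in `[a, a + n%:R * d]) (phi (l * t) * g t)| <=
    n%:R * (e * d + B * (2 * M / `|l|)).
Proof.
move=> cg d0 l0.
have ii x y : mu.-integrable `[x, y] (EFin \o (fun t => phi (l * t) * g t)).
  apply: continuous_integrable_segment => t _.
  by apply: continuousM; [exact: phi_l_cont|exact: cg].
elim: n => [|n IH] ge gB.
  by rewrite !mul0r addr0 set_itv1 Rintegral_set1 normr0.
pose x := a + n%:R * d.
have xS : a + n.+1%:R * d = x + d by rewrite /x -natr1; ring.
have ax : a <= x by rewrite lerDl mulr_ge0.
have xxd : x <= x + d by rewrite lerDl.
have xin : a <= x <= a + n.+1%:R * d by rewrite ax xS.
have wid y : a <= y <= x -> a <= y <= a + n.+1%:R * d.
  by move=> /andP[-> yx]; rewrite xS (le_trans yx).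
have := @Rintegral_itvB _ (fun t => phi (l * t) * g t) (BLeft a)
  (BRight (x + d)) x (ii _ _).
rewrite !bnd_simp => /(_ ax xxd).
rewrite Rintegral_itv_obnd_cbnd; last first.
  by apply: integrableS (ii x (x + d)) => //; exact: subset_itv_oc_cc.
move/eqP; rewrite subr_eq xS => /eqP ->.
apply: (le_trans (ler_normD _ _)); rewrite -natr1 mulrDl mul1r addrC.
apply: lerD.
  apply: IH => [y t /wid yx|y /wid]; [exact: ge|exact: gB].
by apply: piece => // [t|]; [exact: ge|exact: gB].
Qed.

Let riemann_lebesgue_continuous g a b e : continuous g -> a <= b -> 0 < e ->
  exists L : R, forall l, L <= `|l| ->
    `|\int[mu]_(t in `[a, b]) (phi (l * t) * g t)| <= e.
Proof.
move=> cg ab e0.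
(* any c > 0 with b - a <= c would do; b - a itself may vanish *)
pose c := b - a + 1.
have c0 : 0 < c by rewrite /c; lra.
have ec0 : 0 < e / 2 / c by rewrite !divr_gt0.
have [d d0 gd] := @continuous_segment_uniform g a b _ cg ec0.
have [B gB] : exists B, forall x, a <= x <= b -> `|g x| <= B.
  have cng : {within `[a, b], continuous (fun x => `|g x|)}.
    apply: pointwise_continuous_within => x _.
    by apply: (@continuous_comp _ _ _ g (fun u : R => `|u|));
      [exact: cg|exact: norm_continuous].
  have [y _ Hy] := EVT_max ab cng.
  by exists `|g y| => x xab; apply: Hy; rewrite in_itv.
have B0 : 0 <= B by apply: le_trans (gB a _); rewrite ?lexx.
have ba0 : 0 <= b - a by rewrite subr_ge0.
have [n _ /(_ _ (leqnn _)) Hn] : \forall n \near \oo, (b - a) / d < n%:R :> R.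
  exact: nbhs_infty_gtr.
have n0 : 0 < n%:R :> R by apply: le_lt_trans Hn; rewrite divr_ge0// ltW.
pose d' := (b - a) / n%:R.
have bE : b = a + n%:R * d' by rewrite /d' mulrCA mulfV ?gt_eqF// mulr1; ring.
have d'0 : 0 <= d' by rewrite divr_ge0// ltW.
have d'd : d' < d by rewrite /d' ltr_pdivrMr// mulrC -ltr_pdivrMr.
pose K := n%:R * B * (2 * M).
have K0 : 0 <= K by rewrite mulr_ge0 ?mulr_ge0.
(* the added 1 makes l nonzero *)
exists (K / (e / 2) + 1) => l Ll.
have e20 : 0 < e / 2 by rewrite divr_gt0.
have Kl : 0 <= K / (e / 2) by rewrite divr_ge0// ltW.
have l0 : 0 < `|l| by apply: lt_le_trans Ll; lra.
rewrite bE; apply: (le_trans (@pieces g a d' (e / 2 / c) B l n _ _ _ _ _)) => //.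
- by rewrite -normr_gt0.
- rewrite -bE => x t xab /andP[xt tx]; apply: gd => //.
  by rewrite distrC ger0_norm ?subr_ge0//; lra.
- by rewrite -bE.
have -> : n%:R * (e / 2 / c * d' + B * (2 * M / `|l|)) =
    e / 2 * ((b - a) / c) + K / `|l|.
  by rewrite /K /d'; field; rewrite !gt_eqF.
have h1 : e / 2 * ((b - a) / c) <= e / 2.
  by rewrite ler_piMr// ?(ltW e20)// ler_pdivrMr// mul1r /c; lra.
have h2 : K / `|l| <= e / 2.
  rewrite ler_pdivrMr// mulrC -ler_pdivrMr//; lra.
lra.
Qed.

Let phi_l_measurable l (D : set (measurableTypeR R)) :
  measurable_fun D (fun t => phi (l * t)).
Proof.
apply: measurable_funTS; apply: continuous_measurable_fun.
exact: phi_l_cont.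
Qed.

Let phi_P_integrable l P (D : set (measurableTypeR R)) : measurable D ->
  mu.-integrable D (EFin \o P) ->
  mu.-integrable D (EFin \o (fun t => phi (l * t) * P t)).
Proof.
move=> mD; apply: integrable_mul_bounded => //.
Qed.

Let phi_P_le l P (D : set (measurableTypeR R)) : measurable D ->
  mu.-integrable D (EFin \o P) ->
  `|\int[mu]_(t in D) (phi (l * t) * P t)| <= \int[mu]_(t in D) `|P t|.
Proof.
move=> mD iP; have iphiP := phi_P_integrable l mD iP.
apply: (le_trans (le_normr_Rintegral mD iphiP)).
apply: le_Rintegral => //.
- exact: (integrable_abse iphiP).
- exact: (integrable_abse iP).
- by move=> t _; rewrite normrM ler_piMl.
Qed.

(** Oscillation kills integrals over intervals, hence against continuous
    functions, hence, by density in L^1 and a uniform bound, against every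
    integrable function. *)
Lemma riemann_lebesgue P e : mu.-integrable setT (EFin \o P) -> 0 < e ->
  exists L : R, forall l, L <= `|l| ->
    `|\int[mu]_t (phi (l * t) * P t)| <= e.
Proof.
move=> iP e0; have e30 : 0 < e / 3 by rewrite divr_gt0.
have [a [a0 Pa]] := integrable_tail iP e30.
pose D : set (measurableTypeR R) := `[- a, a]%classic; rewrite -/D in Pa.
have mD : measurable D by exact: measurable_itv.
have mCD : measurable (~` D) by exact: measurableC.
have iPD : mu.-integrable D (EFin \o P) by exact: integrableS iP.
have iPCD : mu.-integrable (~` D) (EFin \o P) by exact: integrableS iP.
have Dfin : (mu D < +oo)%E.
  by rewrite /D lebesgue_measure_itv/=; case: ifPn => _; rewrite ltry.
have [g [cg ig Pg]] : exists g : R -> R, [/\ continuous g,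
    mu.-integrable D (EFin \o g) & \int[mu]_(t in D) `|P t - g t| <= e / 3].
  have [g_ [cg ig /fine_fcvg]] := approximation_continuous_integrable mD Dfin iPD.
  move/cvgrPdist_le => /(_ _ e30)[n _ /(_ n (leqnn n))] /=.
  rewrite sub0r normrN => Hn; exists (g_ n); split => //.
  by apply: le_trans Hn; exact: ler_norm.
have aa : - a <= a by rewrite (le_trans _ a0)// oppr_le0.
have [L HL] := riemann_lebesgue_continuous cg aa e30.
exists L => l Ll; have {}HL := HL l Ll.
have iPg : mu.-integrable D (EFin \o (fun t => P t - g t)).
  exact: (integrableB mD iPD ig).
have -> : \int[mu]_t (phi (l * t) * P t) =
    \int[mu]_(t in D) (phi (l * t) * P t) +
    \int[mu]_(t in ~` D) (phi (l * t) * P t).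
  rewrite -[X in Rintegral _ X](setUv D) Rintegral_setU ?setUv//.
    exact: phi_P_integrable.
  by apply/disj_setPS => t []; exact.
have -> : \int[mu]_(t in D) (phi (l * t) * P t) =
    \int[mu]_(t in D) (phi (l * t) * (P t - g t)) +
    \int[mu]_(t in D) (phi (l * t) * g t).
  rewrite -RintegralD//; [|exact: phi_P_integrable|exact: phi_P_integrable].
  by apply: eq_Rintegral => t _; rewrite -mulrDr subrK.
have h1 := phi_P_le l mD iPg.
have h2 := phi_P_le l mCD iPCD.
have -> : e = e / 3 + e / 3 + e / 3 by field.
apply: (le_trans (ler_normD _ _)); apply: lerD; last exact: le_trans h2 Pa.
apply: (le_trans (ler_normD _ _)); apply: lerD; last exact: HL.
exact: le_trans h1 Pg.
Qed.

Lemma continuous_oscillatory_integral P : mu.-integrable setT (EFin \o P) ->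
  continuous (fun l => \int[mu]_t (phi (l * t) * P t)).
Proof.
move=> iP l.
apply: (@continuity_under_integral _ _ _ mu (fun l t => phi (l * t) * P t)
  setT measurableT (l - 1) (l + 1) _ _ (fun t => `|P t|)).
- by move=> x _; exact: phi_P_integrable.
- apply: aeW => t _ x _; apply: continuousM; last exact: cst_continuous.
  apply: (@continuous_comp _ _ _ (fun x => x * t) phi).
    by apply: continuousM; [exact: id|exact: cst_continuous].
  exact: phi_cont.
- exact: (integrable_abse iP).
- by move=> x _; apply: aeW => t _; rewrite normrM ler_piMl.
- by rewrite inE/= in_itv/=; apply/andP; split; lra.
Qed.

End RiemannLebesgue.

(** * Complex-valued functions and their integrals *)

Section ComplexTools.
Context {R : realType}.
Local Open Scope complex_scope.
Local Notation mu := (@lebesgue_measure R).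
Implicit Types (x y : R) (z : R[i]).

Lemma cmodE x y : cmod (x +i* y) = Num.sqrt (x ^+ 2 + y ^+ 2).
Proof. by []. Qed.

Lemma cmodM z1 z2 : cmod (z1 * z2) = cmod z1 * cmod z2.
Proof. exact: Normc.normcM. Qed.

Lemma cmod_ge0 z : 0 <= cmod z.
Proof. by case: z => x y; exact: sqrtr_ge0. Qed.

Lemma cmod_real x : cmod x%:C = `|x|.
Proof. by rewrite /cmod /= expr0n addr0 sqrtr_sqr. Qed.

Lemma cmod_expi x : cmod (expi x) = 1.
Proof. by rewrite cmodE cos2Dsin2 sqrtr1. Qed.

Lemma expiD x y : expi (x + y) = expi x * expi y.
Proof. by rewrite /expi cosD sinD; congr (_ +i* _); rewrite addrC. Qed.

Lemma Re_mulc z1 z2 : complex.Re (z1 * z2) =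
  complex.Re z1 * complex.Re z2 - complex.Im z1 * complex.Im z2.
Proof. by case: z1 z2 => [? ?] [? ?]. Qed.

Lemma Im_mulc z1 z2 : complex.Im (z1 * z2) =
  complex.Re z1 * complex.Im z2 + complex.Im z1 * complex.Re z2.
Proof. by case: z1 z2 => [? ?] [? ?]. Qed.

Lemma cmod_ge_Re z : `|complex.Re z| <= cmod z.
Proof.
by case: z => x y; rewrite cmodE/= -sqrtr_sqr ler_wsqrtr// lerDl sqr_ge0.
Qed.

Lemma cmod_ge_Im z : `|complex.Im z| <= cmod z.
Proof.
by case: z => x y; rewrite cmodE/= -sqrtr_sqr ler_wsqrtr// lerDr sqr_ge0.
Qed.

Lemma cmod_le_ReIm z : cmod z <= `|complex.Re z| + `|complex.Im z|.
Proof.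
case: z => x y; rewrite cmodE/= -[leRHS]ger0_norm ?addr_ge0// -sqrtr_sqr.
rewrite ler_wsqrtr// sqrrD !real_normK ?num_real//.
by rewrite lerD2r lerDl mulrn_wge0 ?mulr_ge0.
Qed.

Lemma cmod_sqr z : cmod z ^+ 2 = complex.Re z ^+ 2 + complex.Im z ^+ 2.
Proof. by case: z => x y; rewrite cmodE sqr_sqrtr ?addr_ge0 ?sqr_ge0. Qed.

(** The left-hand side is the real part of [z1] times the conjugate of [z2]. *)
Lemma cmod_cauchy_schwarz z1 z2 :
  complex.Re z1 * complex.Re z2 + complex.Im z1 * complex.Im z2 <=
  cmod z1 * cmod z2.
Proof.
have := cmod_ge_Re (z1 * z2^*); rewrite cmodM.
have -> : cmod (z2^*) = cmod z2 by case: z2 => x y; rewrite !cmodE/= sqrrN.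
apply: le_trans; apply: le_trans (ler_norm _).
by case: z1 z2 => [x1 y1] [x2 y2]/=; rewrite mulrN opprK.
Qed.

Lemma normC_cmod z : `|z| = (cmod z)%:C.
Proof. by rewrite normc_def; case: z. Qed.

Lemma cplx_cvg_cmod {T : Type} (F : set_system T) (FF : Filter F)
    (f : T -> R[i]^o) (l : R[i]^o) :
  (forall e : R, 0 < e -> \forall t \near F, cmod (l - f t) < e) ->
  f @ F --> l.
Proof.
move=> fl; apply/cvgrPdist_lt => e e0.
(* a positive element of R[i] is real *)
have [eE e'0] : e = (complex.Re e)%:C /\ 0 < complex.Re e.
  by move: e0; rewrite ltcE/= => /andP[/eqP ei ?]; split => //; case: (e) ei => ? ? /= ->.
apply: filterS (fl _ e'0) => t.
by rewrite normC_cmod eE ltcR.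
Qed.

Lemma cplx_continuous (f : R -> R[i]) :
  continuous (fun x => complex.Re (f x)) ->
  continuous (fun x => complex.Im (f x)) ->
  continuous (f : R -> R[i]^o).
Proof.
move=> cR cI x; apply: cplx_cvg_cmod => e e0.
have e20 : 0 < e / 2 by rewrite divr_gt0.
have /cvgrPdist_lt/(_ _ e20) hR := cR x.
have /cvgrPdist_lt/(_ _ e20) hI := cI x.
near=> t; apply: (le_lt_trans (cmod_le_ReIm _)).
have h1 : `|complex.Re (f x) - complex.Re (f t)| < e / 2 by near: t; exact: hR.
have h2 : `|complex.Im (f x) - complex.Im (f t)| < e / 2 by near: t; exact: hI.
move: h1 h2; case: (f x) (f t) => [x1 y1] [x2 y2]/=; lra.
Unshelve. all: by end_near. Qed.

Lemma cplx_vanish (f : R -> R[i]) :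
  (forall e : R, 0 < e -> exists L : R, forall x, L <= `|x| -> cmod (f x) <= e) ->
  (f : R -> R[i]^o) @ +oo --> (0 : R[i]^o) /\
  (f : R -> R[i]^o) @ -oo --> (0 : R[i]^o).
Proof.
move=> Hf; split; apply: cplx_cvg_cmod => e e0;
  have e20 : 0 < e / 2 by rewrite divr_gt0.
- have [L HL] := Hf _ e20; near=> x.
  rewrite sub0r; have -> : cmod (- f x) = cmod (f x).
    by case: (f x) => u v; rewrite !cmodE/= !sqrrN.
  apply: (@le_lt_trans _ _ (e / 2)); last lra.
  apply: HL; apply: le_trans (ler_norm x).
  by near: x; apply: nbhs_pinfty_ge; exact: num_real.
- have [L HL] := Hf _ e20; near=> x.
  rewrite sub0r; have -> : cmod (- f x) = cmod (f x).
    by case: (f x) => u v; rewrite !cmodE/= !sqrrN.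
  apply: (@le_lt_trans _ _ (e / 2)); last lra.
  apply: HL; rewrite -normrN; apply: le_trans (ler_norm (- x)).
  by rewrite lerNr; near: x; apply: nbhs_ninfty_le; exact: num_real.
Unshelve. all: by end_near. Qed.

Definition cintegrable (F : R -> R[i]) :=
  mu.-integrable setT (EFin \o (fun x => complex.Re (F x))) /\
  mu.-integrable setT (EFin \o (fun x => complex.Im (F x))).

Lemma cintegralZ z (F : R -> R[i]) : cintegrable F ->
  cintegral (fun x => z * F x) = z * cintegral F.
Proof.
move=> [iR iI]; case: z => a b; rewrite /cintegral.
have ZR c : mu.-integrable setT (EFin \o (fun x => c * complex.Re (F x))).
  exact: (integrableZl measurableT c iR).
have ZI c : mu.-integrable setT (EFin \o (fun x => c * complex.Im (F x))).
  exact: (integrableZl measurableT c iI).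
have ReM x : complex.Re ((a +i* b) * F x) =
    a * complex.Re (F x) - b * complex.Im (F x) by case: (F x).
have ImM x : complex.Im ((a +i* b) * F x) =
    a * complex.Im (F x) + b * complex.Re (F x) by case: (F x).
under eq_Rintegral do rewrite ReM.
under [X in _ +i* X]eq_Rintegral do rewrite ImM.
by rewrite RintegralB// RintegralD// !RintegralZl.
Qed.

(** Rotating the integral onto the positive axis reduces the triangle
    inequality to the real one; here the rotation is left implicit by pairing
    [F] with the value of its integral. *)
Lemma cmod_cintegral_le (F : R -> R[i]) (N : R -> R) : cintegrable F ->
  mu.-integrable setT (EFin \o N) -> (forall x, cmod (F x) <= N x) ->
  cmod (cintegral F) <= \int[mu]_x N x.
Proof.
move=> [iR iI] iN FN; set z := cintegral F.
have [->|z0] := eqVneq (cmod z) 0.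
  by apply: Rintegral_ge0 => x _; exact: le_trans (cmod_ge0 _) (FN x).
have {z0} z0 : 0 < cmod z by rewrite lt_neqAle eq_sym z0 cmod_ge0.
rewrite -(ler_pM2l z0) -expr2 cmod_sqr.
have ZR : mu.-integrable setT
    (EFin \o (fun x => complex.Re z * complex.Re (F x))).
  exact: (integrableZl measurableT _ iR).
have ZI : mu.-integrable setT
    (EFin \o (fun x => complex.Im z * complex.Im (F x))).
  exact: (integrableZl measurableT _ iI).
have ZN : mu.-integrable setT (EFin \o (fun x => cmod z * N x)).
  exact: (integrableZl measurableT _ iN).
have -> : complex.Re z ^+ 2 + complex.Im z ^+ 2 =
    \int[mu]_x (complex.Re z * complex.Re (F x) + complex.Im z * complex.Im (F x)).
  by rewrite RintegralD// !RintegralZl.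
rewrite -RintegralZl//; apply: le_Rintegral => //.
  exact: (integrableD measurableT ZR ZI).
move=> x _; apply: (le_trans (cmod_cauchy_schwarz _ _)).
by rewrite ler_wpM2l// cmod_ge0.
Qed.

End ComplexTools.

(** * The quadratic-phase Dunkl transform *)

Lemma continuous_quadratic_phase {R : realType} (a d : R) :
  continuous (fun v : R => - (a * v ^+ 2 + d * v)).
Proof.
move=> v; apply: (@continuousN _ _ _ (fun v : R => a * v ^+ 2 + d * v)).
apply: continuousD.
  by apply: continuousM; [exact: cst_continuous|exact: exprn_continuous].
by apply: continuousM; [exact: cst_continuous|exact: id].
Qed.

Section DunklTransform.
Context {R : realType}.
Local Open Scope complex_scope.
Local Notation leb := (@lebesgue_measure R).
Variables (mu : R) (f : R -> R[i]).
Hypothesis hmu : - 2^-1 <= mu.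
Hypothesis hf : inL1 mu f.
Implicit Types (l v w x y : R).

Let N v : R := cmod (f v) * dunkl_weight mu v.

Let weight_ge0 v : 0 <= dunkl_weight mu v. Proof. exact: powR_ge0. Qed.

Let N_ge0 v : 0 <= N v. Proof. by rewrite mulr_ge0 ?cmod_ge0. Qed.

Lemma measurable_dunkl_weight : measurable_fun setT (dunkl_weight mu).
Proof.
apply: (@measurableT_comp _ _ _ _ _ _ ((@powR R) ^~ (2 * mu + 1))).
  exact: measurable_powR.
by apply: continuous_measurable_fun; exact: norm_continuous.
Qed.

Lemma integrable_L1_weight : leb.-integrable setT (EFin \o N).
Proof.
have [[mR mI] fL1] := hf.
have mN : measurable_fun setT N.
  apply: measurable_funM; last exact: measurable_dunkl_weight.
  rewrite (_ : (fun v => cmod (f v)) = fun v =>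
      Num.sqrt (complex.Re (f v) ^+ 2 + complex.Im (f v) ^+ 2)); last first.
    by apply/funext => v; case: (f v).
  apply: (@measurableT_comp _ _ _ _ _ _ (@Num.sqrt R)).
    by apply: continuous_measurable_fun; exact: sqrt_continuous.
  by apply: measurable_funD; apply: measurable_funX.
apply/integrableP; split; first exact/measurable_EFinP.
by under eq_integral do rewrite /= ger0_norm//.
Qed.

Lemma L1normE : L1norm mu f = (\int[leb]_v N v)%:E.
Proof.
rewrite /Rintegral fineK//.
exact: (integrable_fin_num measurableT integrable_L1_weight).
Qed.

(** The chirp splits so that its dependence on [w] leaves the integral as a
    unimodular factor; the weight is included so as to integrate against the
    unweighted Lebesgue measure. *)
Definition chirped (a d v : R) : R[i] :=
  expi (- (a * v ^+ 2 + d * v)) * (f v * (dunkl_weight mu v)%:C).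

Lemma cmod_chirped a d v : cmod (chirped a d v) = N v.
Proof. by rewrite !cmodM cmod_expi mul1r cmod_real ger0_norm. Qed.

Lemma cintegrable_chirped a d : cintegrable (chirped a d).
Proof.
have [[mR mI] _] := hf.
pose th v := - (a * v ^+ 2 + d * v).
have th_cont : continuous th by exact: continuous_quadratic_phase.
have mc : measurable_fun setT (fun v => cos (th v)).
  apply: continuous_measurable_fun => v.
  by apply: (@continuous_comp _ _ _ th cos); [exact: th_cont|exact: continuous_cos].
have ms : measurable_fun setT (fun v => sin (th v)).
  apply: continuous_measurable_fun => v.
  by apply: (@continuous_comp _ _ _ th sin); [exact: th_cont|exact: continuous_sin].
have mw := measurable_dunkl_weight.
have bound (g : R -> R) : measurable_fun setT g -> (forall v, `|g v| <= N v) ->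
    leb.-integrable setT (EFin \o g).
  move=> mg gN; apply: (le_integrable measurableT _ _ integrable_L1_weight).
    exact/measurable_EFinP.
  by move=> v _; rewrite lee_fin /= (ger0_norm (N_ge0 v)).
split; apply: bound => [|v]; rewrite -?(cmod_chirped a d v).
- rewrite (_ : (fun v => _) = fun v =>
    cos (th v) * (complex.Re (f v) * dunkl_weight mu v) -
    sin (th v) * (complex.Im (f v) * dunkl_weight mu v)).
    by apply: measurable_funB; apply: measurable_funM => //; apply: measurable_funM.
  apply/funext => v; rewrite /chirped -/(th v).
  by case: (f v) => x y /=; ring.
- exact: cmod_ge_Re.
- rewrite (_ : (fun v => _) = fun v =>
    cos (th v) * (complex.Im (f v) * dunkl_weight mu v) +
    sin (th v) * (complex.Re (f v) * dunkl_weight mu v)).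
    by apply: measurable_funD; apply: measurable_funM => //; apply: measurable_funM.
  apply/funext => v; rewrite /chirped -/(th v).
  by case: (f v) => x y /=; ring.
- exact: cmod_ge_Im.
Qed.

Let U x : R := besselj mu x.
Let V x : R := x * (besselj (mu + 1) x / (2 * (mu + 1))).

Let kernelE l v : dunkl_kernel mu l v = U (l * v) +i* V (l * v).
Proof. by rewrite /dunkl_kernel /V; congr (_ +i* _); rewrite mulrAC mulrA. Qed.

Lemma cmod_dunkl_kernel_le1 l v : cmod (dunkl_kernel mu l v) <= 1.
Proof.
rewrite kernelE cmodE -[leRHS]sqrtr1 ler_wsqrtr//.
exact: besselj_sqr_le1.
Qed.

Let U_cont : continuous U.
Proof. by move=> x; exact/is_derive_continuous/is_derive_besselj. Qed.

Let V_cont : continuous V.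
Proof. by move=> x; exact/is_derive_continuous/is_derive_mul_besselj. Qed.

Let U_le1 x : `|U x| <= 1. Proof. exact: besselj_le1. Qed.

Let V_le1 x : `|V x| <= 1. Proof. exact: mul_besselj_le1. Qed.

Let V_antiderivative x : is_derive x 1 (fun t => - U t) (V x).
Proof.
by rewrite -[V x]opprK; exact: is_deriveN (is_derive_besselj hmu x).
Qed.

(** Up to a factor of constant modulus, the transform depends on [w] only
    through [l = - w / b]. *)
Let G (a d l : R) : R[i] :=
  cintegral (fun v => dunkl_kernel mu l v * chirped a d v).

Section fixed_chirp.
Variables a d : R.
Let p v := complex.Re (chirped a d v).
Let q v := complex.Im (chirped a d v).
Let ip : leb.-integrable setT (EFin \o p) := (cintegrable_chirped a d).1.
Let iq : leb.-integrable setT (EFin \o q) := (cintegrable_chirped a d).2.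

Let osc_integrable (phi P : R -> R) l : continuous phi ->
  (forall x, `|phi x| <= 1) -> leb.-integrable setT (EFin \o P) ->
  leb.-integrable setT (EFin \o (fun v => phi (l * v) * P v)).
Proof.
move=> cphi phi1 iP; apply: (integrable_mul_bounded measurableT _ _ iP) => //.
apply: continuous_measurable_fun => v.
apply: (@continuous_comp _ _ _ (fun t => l * t) phi); last exact: cphi.
by apply: continuousM; [exact: cst_continuous|exact: id].
Qed.

Let ReE l v : complex.Re (dunkl_kernel mu l v * chirped a d v) =
  U (l * v) * p v - V (l * v) * q v.
Proof. by rewrite kernelE /p /q; case: (chirped a d v). Qed.

Let ImE l v : complex.Im (dunkl_kernel mu l v * chirped a d v) =
  U (l * v) * q v + V (l * v) * p v.
Proof. by rewrite kernelE /p /q; case: (chirped a d v). Qed.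

Lemma cintegrable_dunkl l :
  cintegrable (fun v => dunkl_kernel mu l v * chirped a d v).
Proof.
have Up := osc_integrable l U_cont U_le1 ip.
have Uq := osc_integrable l U_cont U_le1 iq.
have Vp := osc_integrable l V_cont V_le1 ip.
have Vq := osc_integrable l V_cont V_le1 iq.
rewrite /cintegrable (funext (ReE l)) (funext (ImE l)).
split; first exact: (integrableB measurableT Up Vq).
exact: (integrableD measurableT Uq Vp).
Qed.

Let ReG l : complex.Re (G a d l) =
  \int[leb]_v (U (l * v) * p v) - \int[leb]_v (V (l * v) * q v).
Proof.
rewrite /G /cintegral/=; under eq_Rintegral do rewrite ReE.
by rewrite RintegralB//; exact: osc_integrable.
Qed.

Let ImG l : complex.Im (G a d l) =
  \int[leb]_v (U (l * v) * q v) + \int[leb]_v (V (l * v) * p v).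
Proof.
rewrite /G /cintegral/=; under eq_Rintegral do rewrite ImE.
by rewrite RintegralD//; exact: osc_integrable.
Qed.

Let G_cont : continuous (fun l => complex.Re (G a d l)) /\
  continuous (fun l => complex.Im (G a d l)).
Proof.
have cUp := continuous_oscillatory_integral U_cont U_le1 ip.
have cUq := continuous_oscillatory_integral U_cont U_le1 iq.
have cVp := continuous_oscillatory_integral V_cont V_le1 ip.
have cVq := continuous_oscillatory_integral V_cont V_le1 iq.
rewrite (funext ReG) (funext ImG); split => l.
  exact: (continuousB (cUp l) (cVq l)).
exact: (continuousD (cUq l) (cVp l)).
Qed.

Let G_vanish e : 0 < e ->
  exists L : R, forall l, L <= `|l| -> cmod (G a d l) <= e.
Proof.
move=> e0; have e40 : 0 < e / 4 by rewrite divr_gt0.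
have [F [M [dF FM]]] := besselj_bounded_antiderivative hmu.
have NU x : `|- U x| <= 1 by rewrite normrN.
have [L1 H1] := riemann_lebesgue U_cont U_le1 dF FM ip e40.
have [L2 H2] := riemann_lebesgue U_cont U_le1 dF FM iq e40.
have [L3 H3] := riemann_lebesgue V_cont V_le1 V_antiderivative NU ip e40.
have [L4 H4] := riemann_lebesgue V_cont V_le1 V_antiderivative NU iq e40.
exists (Num.max (Num.max L1 L2) (Num.max L3 L4)) => l.
rewrite !ge_max => /andP[/andP[/H1 h1 /H2 h2] /andP[/H3 h3 /H4 h4]].
apply: (le_trans (cmod_le_ReIm _)); rewrite ReG ImG.
apply: (le_trans (lerD (ler_normB _ _) (ler_normD _ _))).
rewrite (_ : e = e / 4 + e / 4 + (e / 4 + e / 4)); last by field.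
by apply: lerD; apply: lerD.
Qed.

Lemma cmod_G_le l : cmod (G a d l) <= \int[leb]_v N v.
Proof.
apply: cmod_cintegral_le; [exact: cintegrable_dunkl|exact: integrable_L1_weight|].
move=> v; rewrite cmodM cmod_chirped ler_piMl//.
exact: cmod_dunkl_kernel_le1.
Qed.

Variables b c e : R.
Hypothesis hb : b != 0.

Let K : R[i] := (dunkl_cst mu)%:C / cpowR (0 +i* b) (mu + 1).

Lemma qpd_transformE w : qpd_transform a b c d e mu f w =
  K * (expi (- (c * w ^+ 2 + e * w)) * G a d (- w / b)).
Proof.
rewrite /G -(cintegralZ _ (cintegrable_dunkl (- w / b))) /qpd_transform -/K.
congr (_ * cintegral _); apply/funext => v.
rewrite /qpd_kernel /chirped.
rewrite (_ : - (a * v ^+ 2 + c * w ^+ 2 + d * v + e * w) =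
  - (c * w ^+ 2 + e * w) + - (a * v ^+ 2 + d * v)); last by ring.
by rewrite expiD; ring.
Qed.

Let dunkl_cst_ge0 : 0 <= dunkl_cst mu.
Proof.
rewrite invr_ge0 mulr_ge0 ?powR_ge0// ltW// Gamma_gt0//; move: hmu; lra.
Qed.

Lemma cmod_qpd_factor : cmod K = dunkl_cst mu / `|b| `^ (mu + 1).
Proof.
rewrite /K cmodM cmod_real (ger0_norm dunkl_cst_ge0); congr (_ * _).
rewrite /cmod Normc.normcV; congr (_^-1).
rewrite -/(cmod _) /cpowR cmodM cmod_expi mulr1 cmod_real ger0_norm ?powR_ge0//.
by rewrite cmodE expr0n add0r sqrtr_sqr.
Qed.

Lemma cmod_qpd_transform w :
  cmod (qpd_transform a b c d e mu f w) = cmod K * cmod (G a d (- w / b)).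
Proof. by rewrite qpd_transformE !cmodM cmod_expi mul1r. Qed.

Lemma qpd_transform_inC0 : inC0 (qpd_transform a b c d e mu f).
Proof.
pose th w := - (c * w ^+ 2 + e * w).
have th_cont : continuous th by exact: continuous_quadratic_phase.
have cc : continuous (fun v => cos (th v)).
  by move=> v; apply: (@continuous_comp _ _ _ th cos);
    [exact: th_cont|exact: continuous_cos].
have cs : continuous (fun v => sin (th v)).
  by move=> v; apply: (@continuous_comp _ _ _ th sin);
    [exact: th_cont|exact: continuous_sin].
have wb_cont : continuous (fun w => - w / b).
  move=> w; apply: continuousM; last exact: cst_continuous.
  exact: opp_continuous.
have [GR GI] := G_cont.
have cst_cont (x : R) : continuous (fun _ : R => x) by exact: cst_continuous.
have cGR : continuous (fun w => complex.Re (G a d (- w / b))).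
  by move=> w; apply: (@continuous_comp _ _ _ (fun w => - w / b)
    (fun l => complex.Re (G a d l))); [exact: wb_cont|exact: GR].
have cGI : continuous (fun w => complex.Im (G a d (- w / b))).
  by move=> w; apply: (@continuous_comp _ _ _ (fun w => - w / b)
    (fun l => complex.Im (G a d l))); [exact: wb_cont|exact: GI].
have cR : continuous (fun w => cos (th w) * complex.Re (G a d (- w / b)) -
    sin (th w) * complex.Im (G a d (- w / b))).
  by move=> w; exact: (continuousB (continuousM (cc w) (cGR w))
    (continuousM (cs w) (cGI w))).
have cI : continuous (fun w => cos (th w) * complex.Im (G a d (- w / b)) +
    sin (th w) * complex.Re (G a d (- w / b))).
  by move=> w; exact: (continuousD (continuousM (cc w) (cGI w))
    (continuousM (cs w) (cGR w))).
have [] := @cplx_vanish _ (qpd_transform a b c d e mu f).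
  move=> r r0; have K10 : 0 < cmod K + 1.
    by apply: (le_lt_trans (cmod_ge0 K)); rewrite ltrDl.
  have [L HL] := G_vanish (divr_gt0 r0 K10).
  exists (L * `|b|) => w Lw; rewrite cmod_qpd_transform.
  have h : cmod (G a d (- w / b)) <= r / (cmod K + 1).
    apply: HL; rewrite normrM normfV normrN ler_pdivlMr// normr_gt0//.
  apply: (le_trans (ler_wpM2l (cmod_ge0 K) h)).
  by rewrite mulrCA ler_piMr ?(ltW r0)// ler_pdivrMr// mul1r lerDl.
move=> vy vNy; split; [|exact: vy|exact: vNy].
apply: cplx_continuous => w.
  rewrite (_ : (fun w => _) = fun w =>
    complex.Re K * (cos (th w) * complex.Re (G a d (- w / b)) -
      sin (th w) * complex.Im (G a d (- w / b))) -
    complex.Im K * (cos (th w) * complex.Im (G a d (- w / b)) +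
      sin (th w) * complex.Re (G a d (- w / b)))).
    exact: (continuousB (continuousM (cst_cont (complex.Re K) w) (cR w))
      (continuousM (cst_cont (complex.Im K) w) (cI w))).
  apply/funext => t; rewrite qpd_transformE -/(th t).
  by rewrite ?Re_mulc ?Im_mulc.
rewrite (_ : (fun w => _) = fun w =>
  complex.Re K * (cos (th w) * complex.Im (G a d (- w / b)) +
    sin (th w) * complex.Re (G a d (- w / b))) +
  complex.Im K * (cos (th w) * complex.Re (G a d (- w / b)) -
    sin (th w) * complex.Im (G a d (- w / b)))).
  exact: (continuousD (continuousM (cst_cont (complex.Re K) w) (cI w))
    (continuousM (cst_cont (complex.Im K) w) (cR w))).
apply/funext => t; rewrite qpd_transformE -/(th t).
by rewrite ?Re_mulc ?Im_mulc.
Qed.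

Lemma qpd_transform_supnorm : (supnorm (qpd_transform a b c d e mu f) <=
  (dunkl_cst mu / `|b| `^ (mu + 1))%:E * L1norm mu f)%E.
Proof.
apply: ge_ereal_sup => _ [w _ <-].
rewrite L1normE -EFinM lee_fin -cmod_qpd_factor cmod_qpd_transform.
by rewrite ler_wpM2l ?cmod_ge0// cmod_G_le.
Qed.

End fixed_chirp.
End DunklTransform.

Theorem proposition3p4 (R : realType) (a b c d e mu : R)
    (hb : b != 0) (hmu : - 2^-1 <= mu)
    (f : R -> R[i]) (hf : inL1 mu f) :
  inC0 (qpd_transform a b c d e mu f) /\
  (supnorm (qpd_transform a b c d e mu f) <=
    (dunkl_cst mu / `|b| `^ (mu + 1))%:E * L1norm mu f)%E.
Proof.
split; first exact: qpd_transform_inC0.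
exact: qpd_transform_supnorm.
Qed.
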